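(* Let $X=X_1\oplus\cdots\oplus X_n$ be an Asplund space. Let $G\subseteq X$ be open and $f:G\to\mathbb R$ a locally Lipschitz function. Suppose that for each $1\le i\le n$ there exists a dense set $D_i\subseteq S_{X_i}$ such that for each $v\in D_i$, $f$ is essentially smooth on a generic line parallel to $v$. Then $f$ is generically Fr\'echet differentiable on $G$.
   Context: $X=X_1\oplus\cdots\oplus X_n$ means $X$ is the direct sum of non-trivial closed linear subspaces $X_1,\ldots,X_n$ and the corresponding projections are continuous. $S_{X_i}$ is the unit sphere of $X_i$. A Banach space is Asplund if every continuous convex real function on it is Fr\'echet differentiable outside a first category set (equivalently, every separable subspace has separable dual). $f$ is generically Fr\'echet differentiable on $G$ if the set of points where $f$ is Fr\'echet differentiable is residual in $G$. A real function $\phi$ on an open subset of a Banach space is strictly differentiable at $a$ if there is $x^*\in X^*$ with $\lim_{(x,y)\to(a,a),x\ne y}\frac{\phi(y)-\phi(x)-x^*(y-x)}{\|y-x\|}=0$. $f$ is essentially smooth on the line $L=a+\mathbb Rv$ ($v\ne0$) if the function $t\mapsto f(a+tv)$ (defined on $\{t: a+tv\in G\}$) is strictly differentiable at almost every point of its domain (Lebesgue measure); this does not depend on the choice of $a,v$. $f$ is essentially smooth on a generic line parallel to $v\ne0$ if $f$ is essentially smooth on all lines $a+\mathbb Rv$ except for a first category set of lines in the quotient space $X/\operatorname{span}\{v\}$. *)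

(* Defs.v *)
From Stdlib Require Import Reals Lra.
Open Scope R_scope.

Record Banach := mkBanach {
  bcar :> Type;
  vzero : bcar;
  vadd : bcar -> bcar -> bcar;
  vopp : bcar -> bcar;
  vscal : R -> bcar -> bcar;
  vnorm : bcar -> R;
  ax_add_assoc : forall x y z, vadd x (vadd y z) = vadd (vadd x y) z;
  ax_add_comm : forall x y, vadd x y = vadd y x;
  ax_add_0 : forall x, vadd x vzero = x;
  ax_add_opp : forall x, vadd x (vopp x) = vzero;
  ax_scal_assoc : forall a b x, vscal a (vscal b x) = vscal (a * b) x;
  ax_scal_1 : forall x, vscal 1 x = x;
  ax_scal_distr_v : forall a x y, vscal a (vadd x y) = vadd (vscal a x) (vscal a y);
  ax_scal_distr_r : forall a b x, vscal (a + b) x = vadd (vscal a x) (vscal b x);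
  ax_norm_eq0 : forall x, vnorm x = 0 -> x = vzero;
  ax_norm_scal : forall a x, vnorm (vscal a x) = Rabs a * vnorm x;
  ax_norm_triangle : forall x y, vnorm (vadd x y) <= vnorm x + vnorm y;
  ax_complete : forall u : nat -> bcar,
    (forall eps, 0 < eps -> exists N, forall m k, (N <= m)%nat -> (N <= k)%nat ->
        vnorm (vadd (u m) (vopp (u k))) < eps) ->
    exists l, forall eps, 0 < eps -> exists N, forall m, (N <= m)%nat ->
        vnorm (vadd (u m) (vopp l)) < eps
}.

Arguments vzero {b0} : rename.
Arguments vadd {b0} : rename.
Arguments vopp {b0} : rename.
Arguments vscal {b0} : rename.
Arguments vnorm {b0} : rename.

Section Defs.
Variable X : Banach.

Definition vsub (x y : X) : X := vadd x (vopp y).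
Definition dist (x y : X) : R := vnorm (vsub x y).

Fixpoint vsum (n : nat) (y : nat -> X) : X :=
  match n with O => vzero | S k => vadd (vsum k y) (y k) end.

Definition ball (x : X) (r : R) (y : X) : Prop := dist y x < r.

Definition is_open (G : X -> Prop) : Prop :=
  forall x, G x -> exists r, 0 < r /\ forall y, ball x r y -> G y.

Definition is_closed (A : X -> Prop) : Prop :=
  forall x, (forall r, 0 < r -> exists y, A y /\ ball x r y) -> A x.

Definition closed_subspace (A : X -> Prop) : Prop :=
  A vzero /\ (forall x y, A x -> A y -> A (vadd x y)) /\
  (forall a x, A x -> A (vscal a x)) /\ is_closed A.

Definition continuous (g : X -> X) : Prop :=
  forall x eps, 0 < eps -> exists delta, 0 < delta /\
    forall y, dist y x < delta -> dist (g y) (g x) < eps.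

Definition continuous_real (g : X -> R) : Prop :=
  forall x eps, 0 < eps -> exists delta, 0 < delta /\
    forall y, dist y x < delta -> Rabs (g y - g x) < eps.

Definition direct_sum (n : nat) (Xi : nat -> X -> Prop) : Prop :=
  (forall i, (i < n)%nat -> closed_subspace (Xi i) /\ exists x, Xi i x /\ x <> vzero) /\
  (forall y z : nat -> X, (forall i, (i < n)%nat -> Xi i (y i)) ->
      (forall i, (i < n)%nat -> Xi i (z i)) -> vsum n y = vsum n z ->
      forall i, (i < n)%nat -> y i = z i) /\
  (exists P : nat -> X -> X,
      (forall i, (i < n)%nat -> continuous (P i)) /\
      (forall i x, (i < n)%nat -> Xi i (P i x)) /\
      (forall x, vsum n (fun i => P i x) = x)).

Definition unit_sphere (A : X -> Prop) (v : X) : Prop := A v /\ vnorm v = 1.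

Definition dense_in (D S : X -> Prop) : Prop :=
  (forall v, D v -> S v) /\
  (forall v eps, S v -> 0 < eps -> exists w, D w /\ dist w v < eps).

(** Baire category w.r.t. a family of (pseudo)metric balls *)
Definition nowhere_dense {T : Type} (bl : T -> R -> T -> Prop) (A : T -> Prop) : Prop :=
  forall x r, 0 < r -> exists y s, 0 < s /\ (forall z, bl y s z -> bl x r z) /\
     (forall z, bl y s z -> ~ A z).

Definition first_category {T : Type} (bl : T -> R -> T -> Prop) (S : T -> Prop) : Prop :=
  exists A : nat -> T -> Prop, (forall k, nowhere_dense bl (A k)) /\
     forall x, S x -> exists k, A k x.

(** Balls of the quotient space X / span{v} (quotient norm), represented on
    representatives: || [y] - [x] || < r  iff  exists t, ||y - x - t v|| < r. *)
Definition qball (v : X) (x : X) (r : R) (y : X) : Prop :=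
  exists t, vnorm (vsub (vsub y x) (vscal t v)) < r.

Definition bounded_linear (l : X -> R) : Prop :=
  (forall x y, l (vadd x y) = l x + l y) /\ (forall a x, l (vscal a x) = a * l x) /\
  (exists C, forall x, Rabs (l x) <= C * vnorm x).

Definition frechet_diff (G : X -> Prop) (f : X -> R) (x : X) : Prop :=
  G x /\ exists l, bounded_linear l /\
    forall eps, 0 < eps -> exists delta, 0 < delta /\
      forall h, vnorm h < delta -> G (vadd x h) ->
        Rabs (f (vadd x h) - f x - l h) <= eps * vnorm h.

Definition generically_frechet_diff (G : X -> Prop) (f : X -> R) : Prop :=
  first_category ball (fun x => G x /\ ~ frechet_diff G f x).

Definition convex_fun (f : X -> R) : Prop :=
  forall x y lam, 0 <= lam <= 1 ->
    f (vadd (vscal lam x) (vscal (1 - lam) y)) <= lam * f x + (1 - lam) * f y.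

Definition Asplund : Prop :=
  forall f : X -> R, continuous_real f -> convex_fun f ->
    generically_frechet_diff (fun _ => True) f.

Definition locally_lipschitz (G : X -> Prop) (f : X -> R) : Prop :=
  forall a, G a -> exists r L, 0 < r /\
    forall x y, G x -> G y -> ball a r x -> ball a r y ->
      Rabs (f x - f y) <= L * dist x y.

End Defs.

Definition lebesgue_null (N : R -> Prop) : Prop :=
  forall eps, 0 < eps -> exists a b : nat -> R,
    (forall k, a k <= b k) /\
    (forall t, N t -> exists k, a k < t < b k) /\
    (forall m, sum_f_R0 (fun k => b k - a k) m <= eps).

Definition strictly_diff (T : R -> Prop) (phi : R -> R) (t0 : R) : Prop :=
  T t0 /\ exists c, forall eps, 0 < eps -> exists delta, 0 < delta /\
    forall s t, T s -> T t -> Rabs (s - t0) < delta -> Rabs (t - t0) < delta -> s <> t ->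
      Rabs (phi t - phi s - c * (t - s)) <= eps * Rabs (t - s).

Definition ess_smooth_on_line (X : Banach) (G : X -> Prop) (f : X -> R) (a v : X) : Prop :=
  lebesgue_null (fun t => G (vadd a (vscal t v)) /\
     ~ strictly_diff (fun s => G (vadd a (vscal s v))) (fun s => f (vadd a (vscal s v))) t).

(** essentially smooth on all lines a + R v outside a first category set of
    lines in X / span{v} *)
Definition ess_smooth_generic_lines (X : Banach) (G : X -> Prop) (f : X -> R) (v : X) : Prop :=
  first_category (qball X v) (fun a => ~ ess_smooth_on_line X G f a v).

(* Main.v *)
(** It suffices to find, inside every ball and for every [eps], a smaller
    ball on which [f] differs from a continuous linear functional by an [eps]-Lipschitz function.

    Baire's theorem in the space of lines, together with almost everywhere strict differentiability,
    shows that for [v] in some [D_i] a difference quotient of [f] below [c] in direction [v] forces all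
    quotients in that direction to be at most [c] on some nearby ball. Hence every direction is generic:
    near any point there are balls on which its quotients oscillate as little as desired. Therefore
    [q x], the supremum of the lower bounds valid on some ball for the quotients in direction [x], is a
    continuous sublinear function of [x]. The Asplund property gives a point [x] of Fréchet
    differentiability of [q], with derivative [l]. On a ball where the quotients in direction [x] almost
    attain [q x], no smaller ball can have all quotients in direction [v] above [l v + eps], since
    otherwise [q (x + d v)] would be too large; by the first step the quotients along [D_i] are then
    within [O(eps)] of [l v] on the whole ball, and the bounded projections sum these estimates. *)

From Stdlib Require Import Reals ZArith Lra Lia List Classical ClassicalEpsilon Cantor.
Require Import Defs.
Open Scope R_scope.

(** * Linear identities between vectors, by reflection *)

Inductive vexp :=
| VVar (n : nat) | VZero | VAdd (a b : vexp) | VOpp (a : vexp) | VScal (r : R) (a : vexp).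

Fixpoint vcoef (e : vexp) (k : nat) : R :=
  match e with
  | VVar n => if Nat.eqb k n then 1 else 0
  | VZero => 0
  | VAdd a b => vcoef a k + vcoef b k
  | VOpp a => - vcoef a k
  | VScal r a => r * vcoef a k
  end.

(** Recursion on the number of atoms, rather than a bounded quantifier, lets [cbn] unfold the
    condition into finitely many real identities. *)
Fixpoint vcoef_agree (n : nat) (a b : vexp) : Prop :=
  match n with
  | O => True
  | S n => vcoef a n = vcoef b n /\ vcoef_agree n a b
  end.

Section VectorExpressions.
Variable X : Banach.

Fixpoint vden (env : list X) (e : vexp) : X :=
  match e with
  | VVar n => nth n env vzero
  | VZero => vzero
  | VAdd a b => vadd (vden env a) (vden env b)
  | VOpp a => vopp (vden env a)
  | VScal r a => vscal r (vden env a)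
  end.

Fixpoint vlin (env : list X) (c : nat -> R) : X :=
  match env with
  | nil => vzero
  | cons x env => vadd (vscal (c O) x) (vlin env (fun k => c (S k)))
  end.

Lemma vadd_0_l (x : X) : vadd vzero x = x.
Proof. now rewrite ax_add_comm, ax_add_0. Qed.

Lemma vadd_cancel_l (x y z : X) : vadd x y = vadd x z -> y = z.
Proof.
  intros H.
  rewrite <- (vadd_0_l y), <- (vadd_0_l z), <- (ax_add_opp _ x), (ax_add_comm _ x).
  now rewrite <- !ax_add_assoc, H.
Qed.

Lemma vscal_0_l (x : X) : vscal 0 x = vzero.
Proof.
  apply (vadd_cancel_l (vscal 0 x)).
  rewrite <- ax_scal_distr_r, ax_add_0. f_equal. ring.
Qed.

Lemma vscal_0_r (a : R) : vscal a (vzero : X) = vzero.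
Proof.
  apply (vadd_cancel_l (vscal a vzero)).
  now rewrite <- ax_scal_distr_v, !ax_add_0.
Qed.

Lemma vopp_scal (x : X) : vopp x = vscal (-1) x.
Proof.
  apply (vadd_cancel_l x). rewrite ax_add_opp.
  rewrite <- (ax_scal_1 _ x) at 1. rewrite <- ax_scal_distr_r.
  replace (1 + -1) with 0 by ring. now rewrite vscal_0_l.
Qed.

Lemma vlin_ext (env : list X) (c d : nat -> R) :
  (forall k, (k < length env)%nat -> c k = d k) -> vlin env c = vlin env d.
Proof.
  revert c d; induction env as [|x env IH]; intros c d H; simpl; trivial.
  rewrite (H O) by (simpl; lia). f_equal.
  apply IH. intros k Hk. apply H. simpl; lia.
Qed.

Lemma vlin_0 (env : list X) (c : nat -> R) : (forall k, c k = 0) -> vlin env c = vzero.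
Proof.
  revert c; induction env as [|x env IH]; intros c H; simpl; trivial.
  rewrite H, vscal_0_l, vadd_0_l. now apply IH.
Qed.

Lemma vlin_add (env : list X) (c d : nat -> R) :
  vadd (vlin env c) (vlin env d) = vlin env (fun k => c k + d k).
Proof.
  revert c d; induction env as [|x env IH]; intros c d; simpl.
  - apply ax_add_0.
  - rewrite <- IH, ax_scal_distr_r.
    rewrite <- !ax_add_assoc. f_equal.
    rewrite !ax_add_assoc. f_equal. apply ax_add_comm.
Qed.

Lemma vlin_scal (env : list X) (a : R) (c : nat -> R) :
  vscal a (vlin env c) = vlin env (fun k => a * c k).
Proof.
  revert c; induction env as [|x env IH]; intros c; simpl.
  - apply vscal_0_r.
  - now rewrite <- IH, ax_scal_distr_v, ax_scal_assoc.
Qed.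

Lemma vlin_var (env : list X) (n : nat) :
  nth n env vzero = vlin env (fun k => if Nat.eqb k n then 1 else 0).
Proof.
  revert n; induction env as [|x env IH]; intros [|n]; simpl; trivial.
  - rewrite (vlin_0 env) by trivial. now rewrite ax_scal_1, ax_add_0.
  - now rewrite IH, vscal_0_l, vadd_0_l.
Qed.

Lemma vden_vlin (env : list X) (e : vexp) : vden env e = vlin env (vcoef e).
Proof.
  induction e as [n| |a IHa b IHb|a IHa|r a IHa]; simpl.
  - apply vlin_var.
  - symmetry. now apply vlin_0.
  - now rewrite IHa, IHb, vlin_add.
  - rewrite vopp_scal, IHa, vlin_scal. apply vlin_ext. intros; ring.
  - now rewrite IHa, vlin_scal.
Qed.

(** Coefficients are compared as if the atoms were linearly independent, which is sound and turns a
    vector identity into real ones. *)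
Lemma vden_eq (env : list X) (a b : vexp) :
  vcoef_agree (length env) a b -> vden env a = vden env b.
Proof.
  intros H. rewrite !vden_vlin. apply vlin_ext.
  revert H. generalize (length env) as n.
  induction n as [|n IH]; intros H k Hk; [lia|].
  destruct H as [H0 H]. destruct (Nat.eq_dec k n) as [->|Hn]; trivial.
  apply IH; trivial; lia.
Qed.
End VectorExpressions.

Ltac vin a l :=
  lazymatch l with
  | nil => constr:(false)
  | cons a _ => constr:(true)
  | cons _ ?l => vin a l
  end.

Ltac vatoms e l :=
  lazymatch e with
  | vzero => l
  | vadd ?a ?b => let l := vatoms a l in vatoms b l
  | vopp ?a => vatoms a l
  | vscal _ ?a => vatoms a l
  | _ => lazymatch vin e l with true => l | false => constr:(cons e l) end
  end.

Ltac vindex a l :=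
  lazymatch l with
  | cons a _ => constr:(O)
  | cons _ ?l => let n := vindex a l in constr:(S n)
  end.

Ltac vquote e l :=
  lazymatch e with
  | vzero => constr:(VZero)
  | vadd ?a ?b => let a := vquote a l in let b := vquote b l in constr:(VAdd a b)
  | vopp ?a => let a := vquote a l in constr:(VOpp a)
  | vscal ?r ?a => let a := vquote a l in constr:(VScal r a)
  | _ => let n := vindex e l in constr:(VVar n)
  end.

Ltac vring :=
  unfold vsub;
  lazymatch goal with
  | |- @eq (bcar ?X) ?a ?b =>
      let l := vatoms a (@nil (bcar X)) in
      let l := vatoms b l in
      let ea := vquote a l in
      let eb := vquote b l in
      change (vden X l ea = vden X l eb);
      apply vden_eq; cbn [vcoef vcoef_agree length Nat.eqb];
      repeat split; try ring; try (field; lra)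
  end.

(** * Norm and distance *)

Section Norm.
Variable X : Banach.
Implicit Types x y z : X.

Lemma vnorm_0 : vnorm (vzero : X) = 0.
Proof. rewrite <- (vscal_0_l X vzero), ax_norm_scal, Rabs_R0. ring. Qed.

Lemma vnorm_opp x : vnorm (vopp x) = vnorm x.
Proof. rewrite vopp_scal, ax_norm_scal, Rabs_left by lra. ring. Qed.

Lemma vnorm_ge0 x : 0 <= vnorm x.
Proof.
  pose proof (ax_norm_triangle _ x (vopp x)) as H.
  rewrite ax_add_opp, vnorm_0, vnorm_opp in H. lra.
Qed.

Lemma vnorm_tri x y z : x = vadd y z -> vnorm x <= vnorm y + vnorm z.
Proof. intros ->. apply ax_norm_triangle. Qed.

Lemma vnorm_scal_ge0 (a : R) x : 0 <= a -> vnorm (vscal a x) = a * vnorm x.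
Proof. intros H. now rewrite ax_norm_scal, Rabs_pos_eq. Qed.

Lemma dist_tri x y z : dist X x z <= dist X x y + dist X y z.
Proof. apply vnorm_tri. vring. Qed.

Lemma dist_sym x y : dist X x y = dist X y x.
Proof. unfold dist. rewrite <- vnorm_opp. f_equal. vring. Qed.

Lemma dist_self x : dist X x x = 0.
Proof. unfold dist, vsub. now rewrite ax_add_opp, vnorm_0. Qed.

Lemma dist_ge0 x y : 0 <= dist X x y.
Proof. apply vnorm_ge0. Qed.

Lemma dist_vadd_r x y z : dist X (vadd x z) (vadd y z) = dist X x y.
Proof. unfold dist. f_equal. vring. Qed.

Lemma dist_vadd_self x z : dist X (vadd x z) x = vnorm z.
Proof. unfold dist. f_equal. vring. Qed.
End Norm.

(** * Baire's theorem, in the space and in its space of lines *)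

Lemma archimed_inv (e : R) : 0 < e -> exists N : nat, / INR (S N) < e.
Proof.
  intros He. destruct (archimed_cor1 e He) as [N [HN Hpos]].
  exists N. apply Rlt_trans with (/ INR N); trivial.
  apply Rinv_lt_contravar.
  - apply Rmult_lt_0_compat; apply lt_0_INR; lia.
  - apply lt_INR; lia.
Qed.

Section Baire.
Variable X : Banach.

(** The non-strict inequalities describe closed balls, which will contain the limit of the nested
    centres; [e] forces the radii to 0. *)
Lemma nowhere_dense_shrink (A : X -> Prop) (x : X) (r e : R) :
  nowhere_dense (ball X) A -> 0 < r -> 0 < e ->
  exists y s, 0 < s < e /\ (forall z, dist X z y <= s -> dist X z x < r) /\
    (forall z, dist X z y <= s -> ~ A z).
Proof.
  intros HA Hr He. destruct (HA x r Hr) as (y & s & Hs & H1 & H2).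
  exists y, (Rmin (s / 2) (e / 2)).
  assert (Hm : Rmin (s / 2) (e / 2) <= s / 2) by apply Rmin_l.
  assert (Hm' : Rmin (s / 2) (e / 2) <= e / 2) by apply Rmin_r.
  assert (0 < Rmin (s / 2) (e / 2)) by (apply Rmin_glb_lt; lra).
  unfold ball in *.
  repeat split; try lra; intros z Hz; [apply H1 | apply H2]; lra.
Qed.

Theorem baire (A : nat -> X -> Prop) (x : X) (r : R) :
  (forall k, nowhere_dense (ball X) (A k)) -> 0 < r ->
  exists y, dist X y x < r /\ forall k, ~ A k y.
Proof.
  intros HA Hr.
  (* [P] is vacuous for a nonpositive radius, so every pair has a successor and choice gives a plain
     recursive sequence. *)
  set (P := fun (k : nat) (p q : X * R) => 0 < snd p ->
    0 < snd q < / INR (S k) /\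
    (forall z, dist X z (fst q) <= snd q -> dist X z (fst p) < snd p) /\
    (forall z, dist X z (fst q) <= snd q -> ~ A k z)).
  assert (Hstep : forall k p, {q | P k p q}).
  { intros k [y s]. apply constructive_indefinite_description.
    destruct (Rlt_dec 0 s) as [Hs|Hs].
    - destruct (nowhere_dense_shrink (A k) y s (/ INR (S k)) (HA k) Hs) as (y' & s' & H).
      { apply Rinv_0_lt_compat, lt_0_INR; lia. }
      now exists (y', s').
    - exists (y, s). intros H; simpl in H; lra. }
  set (c := fix c (k : nat) : X * R :=
    match k with O => (x, r) | S k => proj1_sig (Hstep k (c k)) end).
  assert (HP : forall k, P k (c k) (c (S k))) by (intros k; exact (proj2_sig (Hstep k (c k)))).
  assert (Hpos : forall k, 0 < snd (c k)).
  { induction k as [|k IH]; [exact Hr|]. apply (HP k IH). }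
  assert (Hin : forall m k, (k <= m)%nat -> dist X (fst (c m)) (fst (c k)) <= snd (c k)).
  { intros m k Hkm.
    assert (Hsub : forall j z, dist X z (fst (c (k + j)%nat)) <= snd (c (k + j)%nat) ->
      dist X z (fst (c k)) <= snd (c k)).
    { induction j as [|j IH]; intros z Hz.
      - now rewrite Nat.add_0_r in Hz.
      - rewrite Nat.add_succ_r in Hz. apply IH. left.
        now apply (HP (k + j)%nat (Hpos _)). }
    apply (Hsub (m - k)%nat). replace (k + (m - k))%nat with m by lia.
    rewrite dist_self. left; apply Hpos. }
  assert (Hsmall : forall k, snd (c (S k)) < / INR (S k)) by (intros k; apply (HP k (Hpos k))).
  destruct (ax_complete X (fun k => fst (c k))) as [l Hl].
  { intros e He. destruct (archimed_inv (e / 2)) as [N HN]; [lra|].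
    exists (S N). intros m k Hm Hk.
    pose proof (Hin m (S N) Hm). pose proof (Hin k (S N) Hk).
    pose proof (Hsmall N).
    pose proof (dist_tri X (fst (c m)) (fst (c (S N))) (fst (c k))) as Ht.
    rewrite (dist_sym X (fst (c (S N)))) in Ht.
    change (dist X (fst (c m)) (fst (c k)) < e). lra. }
  (* Were the limit outside the [k]-th closed ball, the later centres, all inside it, would stay
     away from the limit. *)
  assert (Hlim : forall k, dist X l (fst (c k)) <= snd (c k)).
  { intros k. apply Rnot_lt_le. intros Hlt.
    destruct (Hl (dist X l (fst (c k)) - snd (c k))) as [N HN]; [lra|].
    specialize (HN (max N k) (Nat.le_max_l _ _)).
    change (dist X (fst (c (max N k))) l < dist X l (fst (c k)) - snd (c k)) in HN.
    pose proof (Hin (max N k) k (Nat.le_max_r _ _)).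
    pose proof (dist_tri X l (fst (c (max N k))) (fst (c k))) as Ht.
    rewrite (dist_sym X l (fst (c (max N k)))) in Ht. lra. }
  exists l. split.
  - now apply (HP O (Hpos O)).
  - intros k. now apply (HP k (Hpos k)).
Qed.

(** The quotient map is open: a hole around a line is a hole around each of its points, and
    [y - t v] is a point of that line inside the given ball. Baire's theorem in [X] therefore
    handles exceptional sets of lines. *)
Lemma qball_nowhere_dense (v : X) (A : X -> Prop) :
  nowhere_dense (qball X v) A -> nowhere_dense (ball X) A.
Proof.
  intros HA x r Hr. destruct (HA x r Hr) as (y & s & Hs & H1 & H2).
  destruct (H1 y) as [t Ht].
  { exists 0. replace (vsub X (vsub X y y) (vscal 0 v)) with (vzero : X) by vring.
    now rewrite vnorm_0. }
  set (d := vnorm (vsub X (vsub X y x) (vscal t v))) in *.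
  exists (vsub X y (vscal t v)), (Rmin s (r - d)).
  pose proof (Rmin_l s (r - d)). pose proof (Rmin_r s (r - d)).
  assert (0 < Rmin s (r - d)) by (apply Rmin_glb_lt; lra).
  repeat split; trivial.
  - unfold ball, dist. intros z Hz.
    assert (vnorm (vsub X z x) <= vnorm (vsub X z (vsub X y (vscal t v))) + d).
    { apply vnorm_tri. vring. }
    lra.
  - unfold ball, dist. intros z Hz. apply H2. exists (- t).
    replace (vsub X (vsub X z y) (vscal (- t) v)) with (vsub X z (vsub X y (vscal t v))) by vring.
    lra.
Qed.
End Baire.

(** * Increments of Lipschitz functions of a real variable *)

Lemma Rabs_le_bounds (x y : R) : Rabs x <= y -> - y <= x <= y.
Proof. unfold Rabs. destruct Rcase_abs; lra. Qed.

(** For [a <= b] and [0 <= s], [clip a b s - clip a b 0] is the length of the part of [a,b] inside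
    [0,s]. *)
Definition clip (a b s : R) : R := Rmin b (Rmax a s).

Lemma clip_mono (a b s s' : R) : s <= s' -> clip a b s <= clip a b s'.
Proof. unfold clip, Rmin, Rmax; intros; repeat destruct Rle_dec; lra. Qed.

Lemma clip_id (a b s : R) : a <= s <= b -> clip a b s = s.
Proof. unfold clip, Rmin, Rmax; intros; repeat destruct Rle_dec; lra. Qed.

Lemma clip_diff (a b s s' : R) : a <= b -> clip a b s' - clip a b s <= b - a.
Proof. unfold clip, Rmin, Rmax; intros; repeat destruct Rle_dec; lra. Qed.

Lemma sum_f_R0_nonneg_le (u : nat -> R) (m n : nat) :
  (forall k, 0 <= u k) -> (m <= n)%nat -> sum_f_R0 u m <= sum_f_R0 u n.
Proof.
  intros Hu Hmn. induction Hmn as [|n Hmn IH]; [lra|].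
  simpl. specialize (Hu (S n)). lra.
Qed.

Lemma sum_f_R0_term_le (u : nat -> R) (k n : nat) :
  (forall k, 0 <= u k) -> (k <= n)%nat -> u k <= sum_f_R0 u n.
Proof.
  intros Hu Hk. apply Rle_trans with (sum_f_R0 u k).
  - destruct k as [|k]; simpl; [lra|].
    pose proof (cond_pos_sum u k Hu). lra.
  - now apply sum_f_R0_nonneg_le.
Qed.

(** A step may start at or before [s] and end beyond it, so from good points close to their supremum
    one passes the supremum, unless it is [t]. *)
Lemma interval_induction (P : R -> Prop) (t : R) :
  0 <= t -> P 0 ->
  (forall s, 0 <= s <= t -> exists d, 0 < d /\
     forall s1 s2, 0 <= s1 <= t -> 0 <= s2 <= t -> s - d < s1 -> s1 <= s2 -> s2 < s + d ->
       s1 <= s -> P s1 -> P s2) ->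
  P t.
Proof.
  intros Ht H0 Hloc.
  set (E := fun s => 0 <= s <= t /\ P s).
  destruct (completeness E) as [m [Hub Hlub]].
  { exists t. intros s [Hs _]; lra. }
  { exists 0. split; [lra | trivial]. }
  assert (Hm0 : 0 <= m) by (apply Hub; split; [lra | trivial]).
  assert (Hmt : m <= t) by (apply Hlub; intros s [Hs _]; lra).
  destruct (Hloc m) as [d [Hd Hstep]]; [lra|].
  assert (exists s1, E s1 /\ m - d < s1) as (s1 & [Hs1 HP1] & Hs1d).
  { apply NNPP. intros HN. assert (m <= m - d); [|lra].
    apply Hlub. intros s Hs. apply Rnot_lt_le. intros Hlt. apply HN. now exists s. }
  assert (Hs1m : s1 <= m) by (apply Hub; split; trivial).
  set (s2 := Rmin t (m + d / 2)).
  assert (Hs2 : s2 <= t /\ s2 <= m + d / 2) by (split; [apply Rmin_l | apply Rmin_r]).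
  assert (m <= s2) by (apply Rmin_glb; lra).
  assert (HP2 : P s2) by (apply (Hstep s1 s2); lra || trivial).
  assert (s2 <= m) by (apply Hub; split; [lra | trivial]).
  replace t with s2; trivial.
  unfold s2, Rmin in *. destruct Rle_dec; lra.
Qed.

(* Real induction along [0,t]: steps inside the k-th covering interval of N are paid for by
   the growth of the k-th clip function, whose total growth is at most the length of that interval. *)
Theorem increment_lower_bound (phi : R -> R) (N : R -> Prop) (t K c : R) :
  0 <= t ->
  (forall s1 s2, 0 <= s1 <= t -> 0 <= s2 <= t -> Rabs (phi s2 - phi s1) <= K * Rabs (s2 - s1)) ->
  lebesgue_null N ->
  (forall s, 0 <= s <= t -> ~ N s -> exists d, 0 < d /\
     forall s1 s2, 0 <= s1 <= t -> 0 <= s2 <= t -> s - d < s1 -> s1 <= s2 -> s2 < s + d ->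
       c * (s2 - s1) <= phi s2 - phi s1) ->
  c * t <= phi t - phi 0.
Proof.
  intros Ht HK HN Hloc.
  (* Over any step the increment falls short of slope [c] by at most [K'] times the length of the
     step. *)
  set (K' := Rabs K + Rabs c).
  assert (HK' : 0 <= K') by (unfold K'; pose proof (Rabs_pos K); pose proof (Rabs_pos c); lra).
  apply le_epsilon. intros e He.
  destruct (HN (e / (K' + 1))) as (a & b & Hab & Hcov & Hsum).
  { apply Rdiv_lt_0_compat; lra. }
  set (g := fun s k => clip (a k) (b k) s - clip (a k) (b k) 0).
  (* The index [m] depends on the point: it grows whenever a new covering interval is used, and each
     partial sum stays below the total length of the cover. *)
  assert (Hg : exists m, c * t - K' * sum_f_R0 (g t) m <= phi t - phi 0).
  { apply (interval_induction (fun s => exists m, c * s - K' * sum_f_R0 (g s) m <= phi s - phi 0)).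
    - trivial.
    - exists O. unfold g; simpl. lra.
    - intros s Hs. destruct (classic (N s)) as [Hn|Hn].
      + destruct (Hcov s Hn) as [k Hk].
        exists (Rmin (s - a k) (b k - s)). split; [apply Rmin_glb_lt; lra|].
        pose proof (Rmin_l (s - a k) (b k - s)). pose proof (Rmin_r (s - a k) (b k - s)).
        intros s1 s2 H1 H2 Hd1 H12 Hd2 _ [m Hm]. exists (max m k).
        assert (Hd : s2 - s1 <= sum_f_R0 (fun j => g s2 j - g s1 j) (max m k)).
        { apply Rle_trans with (g s2 k - g s1 k).
          - unfold g. rewrite !(clip_id _ _ s1), !(clip_id _ _ s2) by lra. lra.
          - apply (sum_f_R0_term_le (fun j => g s2 j - g s1 j)); [|apply Nat.le_max_r].
            intros j. unfold g. pose proof (clip_mono (a j) (b j) s1 s2). lra. }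
        rewrite minus_sum in Hd.
        assert (Hm' : sum_f_R0 (g s1) m <= sum_f_R0 (g s1) (max m k)).
        { apply sum_f_R0_nonneg_le; [|apply Nat.le_max_l].
          intros j. unfold g. pose proof (clip_mono (a j) (b j) 0 s1). lra. }
        assert (Hinc : - K' * (s2 - s1) + c * (s2 - s1) <= phi s2 - phi s1).
        { pose proof (HK s1 s2 H1 H2) as HL. rewrite (Rabs_pos_eq (s2 - s1)) in HL by lra.
          apply Rabs_le_bounds in HL.
          pose proof (RRle_abs K). pose proof (RRle_abs c). unfold K'. nra. }
        nra.
      + destruct (Hloc s Hs Hn) as [d [Hd Hq]]. exists d. split; trivial.
        intros s1 s2 H1 H2 Hd1 H12 Hd2 _ [m Hm]. exists m.
        pose proof (Hq s1 s2 H1 H2 Hd1 H12 Hd2).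
        assert (sum_f_R0 (g s1) m <= sum_f_R0 (g s2) m).
        { apply sum_Rle. intros j _. unfold g. pose proof (clip_mono (a j) (b j) s1 s2). lra. }
        nra. }
  destruct Hg as [m Hm].
  assert (Hle : sum_f_R0 (g t) m <= e / (K' + 1)).
  { apply Rle_trans with (2 := Hsum m). apply sum_Rle. intros j _. unfold g.
    now apply clip_diff. }
  assert (K' * sum_f_R0 (g t) m <= e).
  { apply Rle_trans with (K' * (e / (K' + 1))); [now apply Rmult_le_compat_l|].
    apply Rmult_le_reg_r with (K' + 1); [lra|].
    replace (K' * (e / (K' + 1)) * (K' + 1)) with (K' * e) by (field; lra). nra. }
  lra.
Qed.

Lemma Rmin_pos_bounds (a b : R) : 0 < a -> 0 < b -> exists c, 0 < c /\ c <= a /\ c <= b.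
Proof.
  intros Ha Hb. exists (Rmin a b).
  split; [now apply Rmin_glb_lt | split; [apply Rmin_l | apply Rmin_r]].
Qed.

Lemma small_factor (d M : R) : 0 < d -> 0 <= M -> exists e, 0 < e /\ e * M < d.
Proof.
  intros Hd HM. exists (d / (M + 1)). split.
  - apply Rdiv_lt_0_compat; lra.
  - apply Rmult_lt_reg_r with (M + 1); [lra|].
    replace (d / (M + 1) * M * (M + 1)) with (d * M) by (field; lra). nra.
Qed.

(** Replaces an arbitrary interval by one of a countable family, as a Baire argument requires. A
    mesh below half the length leaves room for a whole cell. *)
Lemma grid_interval (a b : R) : 0 <= a < b -> exists i m : nat,
  a <= INR i / INR (S m) /\ (INR i + 1) / INR (S m) <= b.
Proof.
  intros [Ha Hab]. destruct (archimed_inv ((b - a) / 2)) as [m Hm]; [lra|].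
  set (M := INR (S m)) in *.
  assert (HM : 0 < M) by (apply lt_0_INR; lia).
  assert (HaM : 0 <= a * M) by nra.
  destruct (archimed (a * M)) as [Hup1 Hup2].
  assert (Hz : (0 <= up (a * M))%Z) by (apply le_IZR; lra).
  exists (Z.to_nat (up (a * M))), m. fold M.
  rewrite INR_IZR_INZ, Z2Nat.id by trivial.
  assert (H2 : 2 < (b - a) * M).
  { apply Rmult_lt_compat_r with (r := M) in Hm; trivial.
    rewrite Rinv_l in Hm by lra. lra. }
  split; apply Rmult_le_reg_r with M; trivial; unfold Rdiv;
    rewrite ?Rmult_assoc, Rinv_l by lra; lra.
Qed.

(** * Calculus of local lower bounds for difference quotients *)

Section LowerSlope.
Variable X : Banach.
Variable f : X -> R.

(* Up to an arbitrarily small loss in [c], this says that the lower Clarke derivative of [f] at [y]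
   in direction [x] is at least [c]. *)
Definition lower_slope (x : X) (c : R) (y : X) : Prop :=
  exists rho, 0 < rho /\ forall w t, dist X w y < rho -> 0 <= t < rho ->
    c * t <= f (vadd w (vscal t x)) - f w.

Lemma lower_slope_open (x : X) (c : R) (y : X) : lower_slope x c y ->
  exists rho, 0 < rho /\ forall z, dist X z y < rho -> lower_slope x c z.
Proof.
  intros (rho & Hr & H). exists (rho / 2). split; [lra|].
  intros z Hz. exists (rho / 2). split; [lra|].
  intros w t Hw Ht. apply H; [|lra].
  pose proof (dist_tri X w z y). lra.
Qed.

Lemma lower_slope_zero (y : X) : lower_slope vzero 0 y.
Proof.
  exists 1. split; [lra|]. intros w t _ _.
  rewrite vscal_0_r, ax_add_0. lra.
Qed.

Lemma lower_slope_le (x : X) (c d : R) (y : X) :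
  d <= c -> lower_slope x c y -> lower_slope x d y.
Proof.
  intros Hd (rho & Hr & H). exists rho. split; trivial.
  intros w t Hw Ht. specialize (H w t Hw Ht). nra.
Qed.

(** The step along [x + x'] is made along [x], then along [x']. The second half starts at a
    displaced point, which is covered because the bounds are uniform in nearby base points. *)
Lemma lower_slope_add (x x' : X) (a b : R) (y : X) :
  lower_slope x a y -> lower_slope x' b y -> lower_slope (vadd x x') (a + b) y.
Proof.
  intros (r1 & Hr1 & H1) (r2 & Hr2 & H2).
  destruct (small_factor (r2 / 2) (vnorm x)) as (e & He & Hex); [lra | apply vnorm_ge0 |].
  destruct (Rmin_pos_bounds r1 (r2 / 2)) as (r3 & Hr3 & H31 & H32); try lra.
  destruct (Rmin_pos_bounds r3 e) as (r4 & Hr4 & H43 & H4e); trivial.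
  exists r4. split; trivial. intros w t Hw Ht.
  assert (Ha := H1 w t ltac:(lra) ltac:(lra)).
  assert (Hd : dist X (vadd w (vscal t x)) y < r2).
  { pose proof (dist_tri X (vadd w (vscal t x)) w y) as Htri.
    rewrite dist_vadd_self, vnorm_scal_ge0 in Htri by lra.
    pose proof (vnorm_ge0 X x). nra. }
  assert (Hb := H2 _ t Hd ltac:(lra)).
  replace (vadd w (vscal t (vadd x x'))) with (vadd (vadd w (vscal t x)) (vscal t x')) by vring.
  lra.
Qed.

Lemma lower_slope_scal (l : R) (x : X) (c : R) (y : X) :
  0 <= l -> lower_slope x c y -> lower_slope (vscal l x) (l * c) y.
Proof.
  intros Hl (r & Hr & H).
  destruct (small_factor r l Hr Hl) as (e & He & Hel).
  destruct (Rmin_pos_bounds r e) as (r' & Hr' & H1 & H2); trivial.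
  exists r'. split; trivial. intros w t Hw Ht.
  assert (Ha := H w (t * l) ltac:(lra) ltac:(nra)).
  rewrite ax_scal_assoc. lra.
Qed.

Variables (U : X -> Prop) (L : R).
Hypothesis U_open : is_open X U.
Hypothesis f_lip : forall x y, U x -> U y -> Rabs (f x - f y) <= L * dist X x y.

(** The endpoints of the two steps of length parameter [t] differ by [t] times the norm of
    [x' - x]. *)
Lemma lower_slope_perturb (x x' : X) (c : R) (y : X) :
  U y -> lower_slope x c y -> lower_slope x' (c - L * vnorm (vsub X x' x)) y.
Proof.
  intros Hy (r & Hr & H). destruct (U_open y Hy) as (s & Hs & HU). unfold ball in HU.
  destruct (small_factor (s / 2) (vnorm x + vnorm x')) as (e & He & Hex); [lra| |].
  { pose proof (vnorm_ge0 X x). pose proof (vnorm_ge0 X x'). lra. }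
  destruct (Rmin_pos_bounds r (s / 2)) as (r3 & Hr3 & H31 & H32); try lra.
  destruct (Rmin_pos_bounds r3 e) as (r4 & Hr4 & H43 & H4e); trivial.
  exists r4. split; trivial. intros w t Hw Ht.
  assert (Ha := H w t ltac:(lra) ltac:(lra)).
  pose proof (vnorm_ge0 X x) as Hx. pose proof (vnorm_ge0 X x') as Hx'.
  assert (HUx : forall z, vnorm z <= vnorm x + vnorm x' -> U (vadd w (vscal t z))).
  { intros z Hz. apply HU.
    pose proof (dist_tri X (vadd w (vscal t z)) w y) as Htri.
    rewrite dist_vadd_self, vnorm_scal_ge0 in Htri by lra.
    pose proof (vnorm_ge0 X z). nra. }
  assert (Hl := f_lip _ _ (HUx x ltac:(lra)) (HUx x' ltac:(lra))).
  apply Rabs_le_bounds in Hl.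
  replace (dist X (vadd w (vscal t x)) (vadd w (vscal t x')))
    with (t * vnorm (vsub X x' x)) in Hl; [nra|].
  rewrite <- vnorm_scal_ge0 by lra. rewrite dist_sym. unfold dist. f_equal. vring.
Qed.

Lemma lower_slope_lip (x y : X) : U y -> lower_slope x (- (L * vnorm x)) y.
Proof.
  intros Hy. replace (- (L * vnorm x)) with (0 - L * vnorm (vsub X x vzero)).
  - apply lower_slope_perturb; trivial. apply lower_slope_zero.
  - replace (vsub X x vzero) with x by vring. ring.
Qed.

(** Adding the Lipschitz bound for the opposite vector gives a lower slope in direction zero, where
    every increment vanishes. *)
Lemma lower_slope_ub (x : X) (c : R) (y : X) : U y -> lower_slope x c y -> c <= L * vnorm x.
Proof.
  intros Hy H.
  pose proof (lower_slope_add _ _ _ _ _ (lower_slope_lip (vopp x) y Hy) H) as (r & Hr & H0).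
  specialize (H0 y (r / 2)). rewrite dist_self in H0.
  replace (vadd y (vscal (r / 2) (vadd (vopp x) x))) with y in H0 by vring.
  rewrite vnorm_opp in H0. specialize (H0 ltac:(lra) ltac:(lra)). nra.
Qed.

(** A lower slope [- b] along [vopp x] means that nearby quotients along [x] are at most [b]; upper
    bounds are encoded this way throughout. *)
Lemma lower_slope_opp (x : X) (a b : R) (y : X) : U y ->
  lower_slope x a y -> lower_slope (vopp x) (- b) y -> a <= b.
Proof.
  intros Hy Ha Hb. pose proof (lower_slope_add _ _ _ _ _ Ha Hb) as H.
  apply lower_slope_ub in H; trivial.
  rewrite ax_add_opp, vnorm_0 in H. lra.
Qed.

(** Passage from local to global: [increment_lower_bound] with empty exceptional set, covered by
    degenerate intervals. *)
Lemma lower_slope_segment (z u : X) (c : R) :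
  (forall s, 0 <= s <= 1 -> U (vadd z (vscal s u)) /\ lower_slope u c (vadd z (vscal s u))) ->
  c <= f (vadd z u) - f z.
Proof.
  intros H.
  pose proof (increment_lower_bound (fun s => f (vadd z (vscal s u))) (fun _ => False) 1
    (L * vnorm u) c) as HI.
  cbv beta in HI.
  replace (vadd z (vscal 1 u)) with (vadd z u) in HI by vring.
  replace (vadd z (vscal 0 u)) with z in HI by vring.
  rewrite Rmult_1_r in HI. apply HI; clear HI; try lra.
  - intros s1 s2 H1 H2. eapply Rle_trans; [apply f_lip; now apply H|].
    right. rewrite Rmult_assoc. f_equal. rewrite Rmult_comm, <- ax_norm_scal.
    unfold dist. f_equal. vring.
  - intros e He. exists (fun _ => 0), (fun _ => 0). repeat split; try lra; try easy.
    intros m. rewrite sum_cte. lra.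
  - intros s Hs _. destruct (H s Hs) as [_ (r & Hr & Hq)].
    destruct (small_factor r (vnorm u) Hr (vnorm_ge0 X u)) as (e & He & Hex).
    destruct (Rmin_pos_bounds (r / 2) e) as (d & Hd & Hd1 & Hd2); [lra | trivial |].
    exists d. split; trivial. intros s1 s2 H1 H2 Hs1 H12 Hs2.
    assert (HA : Rabs (s1 - s) < d) by (apply Rabs_def1; lra).
    assert (Hw : dist X (vadd z (vscal s1 u)) (vadd z (vscal s u)) < r)
      by (replace (dist X (vadd z (vscal s1 u)) (vadd z (vscal s u)))
            with (vnorm (vscal (s1 - s) u)) by (unfold dist; f_equal; vring);
          rewrite ax_norm_scal; pose proof (vnorm_ge0 X u); nra).
    pose proof (Hq _ (s2 - s1) Hw ltac:(lra)) as Hf.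
    now replace (vadd (vadd z (vscal s1 u)) (vscal (s2 - s1) u))
      with (vadd z (vscal s2 u)) in Hf by vring.
Qed.
End LowerSlope.

(** * From one small quotient to a ball of small quotients *)

Section SmoothLines.
Variable X : Banach.
Variables (G U : X -> Prop) (f : X -> R) (L : R).
Hypothesis U_open : is_open X U.
Hypothesis U_sub : forall x, U x -> G x.
Hypothesis L_ge0 : 0 <= L.
Hypothesis f_lip : forall x y, U x -> U y -> Rabs (f x - f y) <= L * dist X x y.

(* This is the only place where almost every, rather than a dense set of, points of the line is needed. *)
Lemma ess_smooth_line_slope (a v : X) (t c : R) :
  vnorm v = 1 -> ess_smooth_on_line X G f a v -> 0 <= t ->
  (forall s, 0 <= s <= t -> U (vadd a (vscal s v))) ->
  f (vadd a (vscal t v)) - f a < c * t ->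
  exists p q, 0 <= p < q /\ q <= t /\ forall s1 s2, p <= s1 -> s1 <= s2 -> s2 <= q ->
    f (vadd a (vscal s2 v)) - f (vadd a (vscal s1 v)) <= c * (s2 - s1).
Proof.
  intros Hv Hess Ht HU Hlt. apply NNPP; intros HN.
  assert (Ha : vadd a (vscal 0 v) = a) by vring.
  assert (Htpos : 0 < t).
  { destruct Ht as [Ht|<-]; trivial. rewrite Ha in Hlt. lra. }
  (* Half of the gap between [c] and the mean slope, so that slope [c - eta] on all of [0,t] is
     still contradictory. *)
  set (eta := (c * t - (f (vadd a (vscal t v)) - f a)) / (2 * t)).
  assert (Heta : 0 < eta) by (apply Rdiv_lt_0_compat; lra).
  assert (Het : eta * t * 2 = c * t - (f (vadd a (vscal t v)) - f a)) by (unfold eta; field; lra).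
  assert (HI : (c - eta) * t <= f (vadd a (vscal t v)) - f (vadd a (vscal 0 v))).
  { apply (increment_lower_bound (fun s => f (vadd a (vscal s v))) _ t L (c - eta) Ht) with (2 := Hess).
    - intros s1 s2 H1 H2. eapply Rle_trans; [apply f_lip; now apply HU|].
      right. f_equal.
      replace (dist X (vadd a (vscal s2 v)) (vadd a (vscal s1 v)))
        with (vnorm (vscal (s2 - s1) v)) by (unfold dist; f_equal; vring).
      rewrite ax_norm_scal, Hv. ring.
    - intros s Hs Hns.
      assert (Hsd : strictly_diff (fun s => G (vadd a (vscal s v))) (fun s => f (vadd a (vscal s v))) s).
      { apply NNPP. intros Hn. apply Hns. split; auto. }
      destruct Hsd as [_ [c0 Hc0]].
      (* A strict derivative below [c] would give the interval excluded by [HN]; otherwise nearby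
         quotients are at least [c - eta]. *)
      destruct (Rlt_le_dec c0 c) as [Hc|Hc].
      + exfalso. apply HN. destruct (Hc0 (c - c0)) as [d [Hd Hq]]; [lra|].
        assert (Hpq : Rmax 0 (s - d / 2) < Rmin t (s + d / 2))
          by (unfold Rmax, Rmin; repeat destruct Rle_dec; lra).
        pose proof (Rmax_l 0 (s - d / 2)). pose proof (Rmax_r 0 (s - d / 2)).
        pose proof (Rmin_l t (s + d / 2)). pose proof (Rmin_r t (s + d / 2)).
        exists (Rmax 0 (s - d / 2)), (Rmin t (s + d / 2)). repeat split; trivial.
        intros s1 s2 Hs1 H12 Hs2. destruct (Req_dec s1 s2) as [<-|Hne]; [lra|].
        specialize (Hq s1 s2 ltac:(apply U_sub, HU; lra) ltac:(apply U_sub, HU; lra)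
          ltac:(apply Rabs_def1; lra) ltac:(apply Rabs_def1; lra) Hne).
        rewrite (Rabs_pos_eq (s2 - s1)) in Hq by lra.
        apply Rabs_le_bounds in Hq. lra.
      + destruct (Hc0 eta Heta) as [d [Hd Hq]]. exists d. split; trivial.
        intros s1 s2 H1 H2 Hs1 H12 Hs2. destruct (Req_dec s1 s2) as [<-|Hne]; [lra|].
        specialize (Hq s1 s2 ltac:(apply U_sub, HU; lra) ltac:(apply U_sub, HU; lra)
          ltac:(apply Rabs_def1; lra) ltac:(apply Rabs_def1; lra) Hne).
        rewrite (Rabs_pos_eq (s2 - s1)) in Hq by lra.
        apply Rabs_le_bounds in Hq. nra. }
  rewrite Ha in HI. nra.
Qed.

(** The strict inequality survives small translations of the segment, so almost all translates, in
    the sense of category, contain an interval with quotients at most [c]. One interval of a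
    countable grid then serves a somewhere dense set of translates, and by continuity a ball of
    them. *)
Lemma ess_smooth_segment_slope (v : X) (c : R) (y w : X) (r t : R) :
  vnorm v = 1 -> ess_smooth_generic_lines X G f v ->
  (forall z, dist X z y < r -> U z) -> 0 <= t -> dist X w y + t < r ->
  f (vadd w (vscal t v)) - f w < c * t ->
  exists z, dist X z y < r /\ lower_slope X f (vopp v) (- c) z.
Proof.
  intros Hv (A & HA & Hcov) HUy Ht Hwt Hlt.
  assert (Hbd : forall a s, 0 <= s <= t -> dist X (vadd a (vscal s v)) y <= dist X a w + dist X w y + t).
  { intros a s Hs. pose proof (dist_tri X (vadd a (vscal s v)) a y) as H1.
    rewrite dist_vadd_self, vnorm_scal_ge0, Hv in H1 by lra.
    pose proof (dist_tri X a w y). lra. }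
  assert (Hww : dist X w w = 0) by apply dist_self.
  (* Translating by less than [e] changes each of the two endpoint values by at most [L * e]. *)
  destruct (small_factor (c * t - (f (vadd w (vscal t v)) - f w)) (2 * L)) as (e & He & HeL); try lra.
  destruct (Rmin_pos_bounds e (r - (dist X w y + t))) as (r1 & Hr1 & Hr1e & Hr1r); try lra.
  assert (HUa : forall a, dist X a w < r1 -> forall s, 0 <= s <= t -> U (vadd a (vscal s v))).
  { intros a Ha s Hs. apply HUy. specialize (Hbd a s Hs). lra. }
  assert (Hdec : forall a, dist X a w < r1 -> f (vadd a (vscal t v)) - f a < c * t).
  { intros a Ha.
    assert (H1 := f_lip _ _ (HUa a Ha t ltac:(lra)) (HUa w ltac:(lra) t ltac:(lra))).
    assert (H2 := f_lip _ _ (HUa a Ha 0 ltac:(lra)) (HUa w ltac:(lra) 0 ltac:(lra))).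
    rewrite dist_vadd_r in H1, H2. apply Rabs_le_bounds in H1. apply Rabs_le_bounds in H2.
    replace (vadd a (vscal 0 v)) with a in H2 by vring.
    replace (vadd w (vscal 0 v)) with w in H2 by vring.
    pose proof (dist_ge0 X a w). nra. }
  set (p := fun i m : nat => INR i / INR (S m)).
  set (q := fun i m : nat => (INR i + 1) / INR (S m)).
  assert (HM : forall m, 0 < INR (S m)) by (intros m; apply lt_0_INR; lia).
  assert (Hp0 : forall i m, 0 <= p i m).
  { intros i m. apply Rmult_le_pos; [apply pos_INR|]. left. now apply Rinv_0_lt_compat. }
  assert (Hpq : forall i m, p i m < q i m).
  { intros i m. apply Rmult_lt_compat_r; [now apply Rinv_0_lt_compat | lra]. }
  set (E := fun i m a => dist X a w < r1 /\ q i m <= t /\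
    forall s1 s2, p i m <= s1 -> s1 <= s2 -> s2 <= q i m ->
      f (vadd a (vscal s2 v)) - f (vadd a (vscal s1 v)) <= c * (s2 - s1)).
  assert (HE : exists i m, ~ nowhere_dense (ball X) (E i m)).
  { apply NNPP. intros HN.
    (* Codes [(i, 0)] enumerate the exceptional sets of lines, codes [(i, S m)] the sets [E i m]. *)
    destruct (baire X (fun k => match Cantor.of_nat k with (i, O) => A i | (i, S m) => E i m end) w r1)
      as (a & Ha & Hout); trivial.
    { intros k. destruct (Cantor.of_nat k) as [i [|m]].
      - now apply (qball_nowhere_dense X v).
      - apply NNPP. intros Hn. apply HN. now exists i, m. }
    assert (Hess : ess_smooth_on_line X G f a v).
    { apply NNPP. intros Hn. destruct (Hcov a Hn) as [i Hi].
      apply (Hout (Cantor.to_nat (i, O))). now rewrite Cantor.cancel_of_to. }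
    destruct (ess_smooth_line_slope a v t c Hv Hess Ht (HUa a Ha) (Hdec a Ha))
      as (p' & q' & Hpq' & Hqt & Hs).
    destruct (grid_interval p' q') as (i & m & Hi & Hm); [lra|].
    apply (Hout (Cantor.to_nat (i, S m))). rewrite Cantor.cancel_of_to.
    repeat split; trivial.
    - unfold q. lra.
    - intros s1 s2 H1 H12 H2. apply Hs; trivial; unfold p, q in *; lra. }
  destruct HE as (i & m & HE).
  (* The negation of nowhere density: [E i m] is dense in some ball. *)
  assert (exists a0 r0, 0 < r0 /\ forall a s, 0 < s ->
    (forall z, dist X z a < s -> dist X z a0 < r0) -> exists z, dist X z a < s /\ E i m z)
    as (a0 & r0 & Hr0 & Hdense).
  { apply NNPP. intros HN. apply HE. intros a0 r0 Hr0. apply NNPP. intros HN2.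
    apply HN. exists a0, r0. split; trivial. intros a s Hs Hsub.
    apply NNPP. intros HN3. apply HN2. exists a, s. repeat split; trivial.
    intros z Hz HEz. apply HN3. now exists z. }
  destruct (Hdense a0 r0 Hr0) as (a1 & Ha1 & (Ha1w & Hqt & _)); [trivial|].
  destruct (Rmin_pos_bounds (r1 - dist X a1 w) (r0 - dist X a1 a0)) as (r2 & Hr2 & Hr2a & Hr2b); try lra.
  (* The inequality defining [E i m] is closed in [a], so it passes from a dense set to all points
     near [a1]. *)
  assert (Hclosed : forall a s1 s2, dist X a a1 < r2 -> p i m <= s1 -> s1 <= s2 -> s2 <= q i m ->
    f (vadd a (vscal s2 v)) - f (vadd a (vscal s1 v)) <= c * (s2 - s1)).
  { intros a s1 s2 Ha H1 H12 H2. apply le_epsilon. intros eps Heps.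
    destruct (small_factor eps (2 * L)) as (e' & He' & HeL'); try lra.
    destruct (Rmin_pos_bounds e' (r2 - dist X a a1)) as (e2 & He2 & Hee & Her); try lra.
    destruct (Hdense a e2 He2) as (b & Hb & (Hbw & _ & Hbs)).
    { intros z Hz. pose proof (dist_tri X z a a0). pose proof (dist_tri X a a1 a0). lra. }
    assert (Haw : dist X a w < r1) by (pose proof (dist_tri X a a1 w); lra).
    specialize (Hbs s1 s2 H1 H12 H2). specialize (Hp0 i m).
    assert (K1 := f_lip _ _ (HUa a Haw s1 ltac:(lra)) (HUa b Hbw s1 ltac:(lra))).
    assert (K2 := f_lip _ _ (HUa a Haw s2 ltac:(lra)) (HUa b Hbw s2 ltac:(lra))).
    rewrite dist_vadd_r, dist_sym in K1, K2.
    apply Rabs_le_bounds in K1. apply Rabs_le_bounds in K2. nra. }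
  specialize (Hp0 i m). specialize (Hpq i m).
  (* At the midpoint, a backward step of length at most [q i m - s0] remains in the grid
     interval. *)
  set (s0 := (p i m + q i m) / 2).
  exists (vadd a1 (vscal s0 v)). split.
  { specialize (Hbd a1 s0 ltac:(unfold s0; lra)). lra. }
  destruct (Rmin_pos_bounds r2 (q i m - s0)) as (r3 & Hr3 & Hr32 & Hr3q); [lra | unfold s0; lra |].
  exists r3. split; trivial. intros b s Hb Hs.
  assert (Ha : dist X (vadd b (vscal (- s0) v)) a1 < r2).
  { replace a1 with (vadd (vadd a1 (vscal s0 v)) (vscal (- s0) v)) by vring.
    rewrite dist_vadd_r. lra. }
  assert (Hf := Hclosed _ (s0 - s) s0 Ha ltac:(unfold s0 in *; lra) ltac:(lra) ltac:(unfold s0; lra)).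
  replace (vadd (vadd b (vscal (- s0) v)) (vscal s0 v)) with b in Hf by vring.
  replace (vadd (vadd b (vscal (- s0) v)) (vscal (s0 - s) v)) with (vadd b (vscal s (vopp v))) in Hf by vring.
  lra.
Qed.

(** A single quotient below [c] near [z] would, by [ess_smooth_segment_slope], produce a point of
    the ball that the hypothesis excludes. *)
Lemma ess_smooth_slope_dichotomy (v : X) (c : R) (y : X) (r : R) :
  vnorm v = 1 -> ess_smooth_generic_lines X G f v ->
  (forall z, dist X z y < r -> U z) ->
  (forall z, dist X z y < r -> ~ lower_slope X f (vopp v) (- c) z) ->
  forall z, dist X z y < r -> lower_slope X f v c z.
Proof.
  intros Hv Hess HUy Hno z Hz. exists ((r - dist X z y) / 2). split; [lra|].
  intros w t Hw Ht. apply Rnot_lt_le. intros Hlt.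
  pose proof (dist_tri X w z y).
  destruct (ess_smooth_segment_slope v c y w r t) as (z' & Hz' & Hlow); trivial; try lra.
  now apply (Hno z').
Qed.
End SmoothLines.

(** * Directions in which the quotients oscillate little near densely many points *)

Section GenericDirections.
Variable X : Banach.
Variables (G U : X -> Prop) (f : X -> R) (L : R).
Hypothesis U_open : is_open X U.
Hypothesis U_sub : forall x, U x -> G x.
Hypothesis L_ge0 : 0 <= L.
Hypothesis f_lip : forall x y, U x -> U y -> Rabs (f x - f y) <= L * dist X x y.

(** Near [z] the quotients along [x] lie between [a] and [a + eta]. By [lower_slope_open] the set of
    such [z] is open, so finitely many directions can be treated one after the other. *)
Definition generic_direction (x : X) : Prop :=
  forall y r, 0 < r -> (forall z, dist X z y < r -> U z) -> forall eta, 0 < eta ->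
  exists z a, dist X z y < r /\
    lower_slope X f x a z /\ lower_slope X f (vopp x) (- (a + eta)) z.

Lemma generic_direction_zero : generic_direction vzero.
Proof.
  intros y r Hr HUy eta Heta. exists y, 0. rewrite dist_self.
  replace (vopp vzero) with (vzero : X) by vring.
  repeat split; trivial; [apply lower_slope_zero|].
  apply lower_slope_le with (c := 0); [lra | apply lower_slope_zero].
Qed.

Lemma generic_direction_add (x x' : X) :
  generic_direction x -> generic_direction x' -> generic_direction (vadd x x').
Proof.
  intros H H' y r Hr HUy eta Heta.
  destruct (H y r Hr HUy (eta / 2)) as (z & a & Hz & Ha & Hna); [lra|].
  destruct (lower_slope_open _ _ _ _ _ Ha) as (r1 & Hr1 & Ho1).
  destruct (lower_slope_open _ _ _ _ _ Hna) as (r2 & Hr2 & Ho2).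
  destruct (Rmin_pos_bounds r1 r2) as (r3 & Hr3 & H31 & H32); trivial.
  destruct (Rmin_pos_bounds r3 (r - dist X z y)) as (r4 & Hr4 & H43 & H4y); try lra.
  assert (Hsub : forall z', dist X z' z < r4 -> dist X z' y < r).
  { intros z' Hz'. pose proof (dist_tri X z' z y). lra. }
  destruct (H' z r4 Hr4 (fun z' Hz' => HUy z' (Hsub z' Hz')) (eta / 2))
    as (z' & b & Hz' & Hb & Hnb); [lra|].
  exists z', (a + b). repeat split; auto.
  - apply lower_slope_add; trivial. apply Ho1; lra.
  - replace (vopp (vadd x x')) with (vadd (vopp x) (vopp x')) by vring.
    replace (- (a + b + eta)) with (- (a + eta / 2) + - (b + eta / 2)) by field.
    apply lower_slope_add; trivial. apply Ho2; lra.
Qed.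

Lemma generic_direction_scal (l : R) (x : X) :
  0 <= l -> generic_direction x -> generic_direction (vscal l x).
Proof.
  intros Hl H y r Hr HUy eta Heta.
  destruct (small_factor eta l Heta Hl) as (e & He & Hel).
  destruct (H y r Hr HUy e He) as (z & a & Hz & Ha & Hna).
  exists z, (l * a). repeat split; trivial.
  - now apply lower_slope_scal.
  - replace (vopp (vscal l x)) with (vscal l (vopp x)) by vring.
    apply lower_slope_le with (c := l * - (a + e)); [nra|]. now apply lower_slope_scal.
Qed.

Lemma generic_direction_limit (x : X) :
  (forall e, 0 < e -> exists x', generic_direction x' /\ dist X x' x < e) -> generic_direction x.
Proof.
  intros H y r Hr HUy eta Heta.
  (* Exchanging [x'] for [x] moves each of the two bounds by less than [eta / 4]. *)
  destruct (small_factor eta (4 * L)) as (e & He & HeL); try lra.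
  destruct (H e He) as (x' & Hx' & Hd).
  destruct (Hx' y r Hr HUy (eta / 2)) as (z & a & Hz & Ha & Hna); [lra|].
  pose proof (HUy z Hz) as HUz.
  apply (lower_slope_perturb X f U L) with (x' := x) in Ha; trivial.
  apply (lower_slope_perturb X f U L) with (x' := vopp x) in Hna; trivial.
  rewrite dist_sym in Hd. unfold dist in Hd.
  replace (vsub X (vopp x) (vopp x')) with (vopp (vsub X x x')) in Hna by vring.
  rewrite vnorm_opp in Hna. set (d := vnorm (vsub X x x')) in *.
  assert (0 <= d) by apply vnorm_ge0.
  exists z, (a - L * d). repeat split; trivial.
  apply lower_slope_le with (2 := Hna). nra.
Qed.

(** Choose [c] within [eta] of the supremum of the lower slopes in the ball. Near the point
    realizing [c] the slope [c + eta] is unattainable, so the dichotomy yields an upper bound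
    [c + eta] at a point where [c] is still a lower bound. *)
Lemma generic_direction_ess_smooth (v : X) :
  vnorm v = 1 -> ess_smooth_generic_lines X G f v -> generic_direction v.
Proof.
  intros Hv Hess y r Hr HUy eta Heta.
  set (E := fun c => exists z, dist X z y < r /\ lower_slope X f v c z).
  destruct (completeness E) as [m [Hub Hlub]].
  { exists (L * vnorm v). intros c (z & Hz & Hc).
    now apply (lower_slope_ub X f U L) with (y := z); auto. }
  { exists (- (L * vnorm v)), y. rewrite dist_self. split; trivial.
    apply (lower_slope_lip X f U L); auto. apply HUy. now rewrite dist_self. }
  assert (exists c, E c /\ m - eta < c) as (c & (z & Hz & Hc) & Hcm).
  { apply NNPP. intros HN. assert (m <= m - eta); [|lra].
    apply Hlub. intros c Hc. apply Rnot_lt_le. intros Hlt. apply HN. now exists c. }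
  destruct (lower_slope_open _ _ _ _ _ Hc) as (r1 & Hr1 & Ho).
  destruct (Rmin_pos_bounds r1 (r - dist X z y)) as (r2 & Hr2 & H21 & H2y); try lra.
  assert (Hsub : forall z', dist X z' z < r2 -> dist X z' y < r).
  { intros z' Hz'. pose proof (dist_tri X z' z y). lra. }
  apply NNPP. intros HN.
  assert (E (c + eta)).
  { exists z. split; trivial.
    apply (ess_smooth_slope_dichotomy X G U f L) with (y := z) (r := r2); auto.
    - intros z' Hz' Hlow. apply HN. exists z', c. repeat split; auto. apply Ho; lra.
    - now rewrite dist_self. }
  assert (c + eta <= m) by now apply Hub. lra.
Qed.

(** * The support function and its point of differentiability *)

Hypothesis all_generic : forall x, generic_direction x.
Hypothesis X_asplund : Asplund X.

(* The function [q] below plays the role of the support function of the set of derivatives of [f];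
   it is defined for arbitrary [f], but only genericity of all directions makes it convex. *)
Lemma asplund_slope_bound (y0 : X) (eps : R) : U y0 -> 0 < eps ->
  exists l y r, bounded_linear X l /\ 0 < r /\ (forall z, dist X z y < r -> U z) /\
    forall v z a, vnorm v = 1 -> dist X z y < r -> lower_slope X f v a z -> a <= l v + eps.
Proof.
  intros Hy0 Heps.
  set (E := fun x c => exists z, U z /\ lower_slope X f x c z).
  assert (Hlub : forall x, {m | is_lub (E x) m}).
  { intros x. apply completeness.
    - exists (L * vnorm x). intros c (z & Hz & Hc).
      now apply (lower_slope_ub X f U L) with (y := z).
    - exists (- (L * vnorm x)), y0. split; trivial. now apply (lower_slope_lip X f U L). }
  set (q := fun x => proj1_sig (Hlub x)).
  assert (Hub : forall x c z, U z -> lower_slope X f x c z -> c <= q x).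
  { intros x c z Hz Hc. apply (proj2_sig (Hlub x)). now exists z. }
  assert (Hle : forall x m, (forall c z, U z -> lower_slope X f x c z -> c <= m) -> q x <= m).
  { intros x m Hm. apply (proj2_sig (Hlub x)). intros c (z & Hz & Hc). now apply (Hm c z). }
  assert (Hlip : forall x x', q x <= q x' + L * vnorm (vsub X x' x)).
  { intros x x'. apply Hle. intros c z Hz Hc.
    apply (lower_slope_perturb X f U L) with (x' := x') in Hc; trivial.
    apply Hub in Hc; trivial. lra. }
  assert (Hcont : continuous_real X q).
  { intros x e He. destruct (small_factor e L He L_ge0) as (d & Hd & HdL).
    exists d. split; trivial. intros x' Hx'.
    pose proof (Hlip x x') as H1. pose proof (Hlip x' x) as H2.
    change (vnorm (vsub X x' x)) with (dist X x' x) in H1.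
    change (vnorm (vsub X x x')) with (dist X x x') in H2.
    rewrite dist_sym in H2. pose proof (dist_ge0 X x' x). apply Rabs_def1; nra. }
  (* Moving from [z] to [z1] and then to [z2] keeps earlier bounds, so at [z2] the slope [c] of the
     combination meets upper bounds [a + eta] and [b + eta] for [x] and [x'], while [a <= q x] and
     [b <= q x']. *)
  assert (Hconv : convex_fun X q).
  { intros x x' lam Hlam. apply Hle. intros c z Hz Hc.
    apply le_epsilon. intros eta Heta.
    destruct (U_open z Hz) as (r1 & Hr1 & HU1).
    destruct (lower_slope_open _ _ _ _ _ Hc) as (r2 & Hr2 & Ho2).
    destruct (Rmin_pos_bounds r1 r2) as (r3 & Hr3 & H31 & H32); trivial.
    destruct (all_generic x z r3 Hr3) with (eta := eta) as (z1 & a & Hz1 & Ha & Hna); trivial.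
    { intros z' Hz'. apply HU1. unfold ball. lra. }
    destruct (lower_slope_open _ _ _ _ _ Ha) as (r4 & Hr4 & Ho4).
    destruct (lower_slope_open _ _ _ _ _ Hna) as (r5 & Hr5 & Ho5).
    destruct (Rmin_pos_bounds r4 r5) as (r6 & Hr6 & H64 & H65); trivial.
    destruct (Rmin_pos_bounds r6 (r3 - dist X z1 z)) as (r7 & Hr7 & H76 & H73); try lra.
    assert (Hsub : forall z', dist X z' z1 < r7 -> dist X z' z < r3).
    { intros z' Hz'. pose proof (dist_tri X z' z1 z). lra. }
    assert (HU : forall z', dist X z' z < r3 -> U z') by (intros z' Hz'; apply HU1; unfold ball; lra).
    destruct (all_generic x' z1 r7 Hr7) with (eta := eta) as (z2 & b & Hz2 & Hb & Hnb); auto.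
    assert (HUz2 : U z2) by auto.
    specialize (Hsub z2 Hz2).
    assert (Ha2 := Ho4 z2 ltac:(lra)). assert (Hna2 := Ho5 z2 ltac:(lra)).
    assert (Hc2 := Ho2 z2 ltac:(lra)).
    assert (Hn : lower_slope X f (vopp (vadd (vscal lam x) (vscal (1 - lam) x')))
      (- (lam * (a + eta) + (1 - lam) * (b + eta))) z2).
    { replace (vopp (vadd (vscal lam x) (vscal (1 - lam) x')))
        with (vadd (vscal lam (vopp x)) (vscal (1 - lam) (vopp x'))) by vring.
      replace (- (lam * (a + eta) + (1 - lam) * (b + eta)))
        with (lam * - (a + eta) + (1 - lam) * - (b + eta)) by ring.
      apply lower_slope_add; apply lower_slope_scal; trivial; lra. }
    pose proof (lower_slope_opp X f U L U_open f_lip _ _ _ _ HUz2 Hc2 Hn).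
    apply Hub in Ha2; trivial. apply Hub in Hb; trivial. nra. }
  destruct (X_asplund q Hcont Hconv) as (A & HA & Hcov).
  destruct (baire X A vzero 1 HA) as (x & _ & Hx); [lra|].
  assert (Hdiff : frechet_diff X (fun _ => True) q x).
  { apply NNPP. intros Hn. destruct (Hcov x) as [k Hk]; [now split|]. now apply (Hx k). }
  destruct Hdiff as [_ (l & Hl & Hd)].
  destruct (Hd (eps / 2)) as (d & Hdpos & Hq); [lra|].
  (* The defect in attaining [q x] must be small relative to the increment [d / 2] used below. *)
  assert (exists c y, U y /\ lower_slope X f x c y /\ q x - eps / 2 * (d / 2) < c)
    as (c & y & Hy & Hc & Hqc).
  { apply NNPP. intros HN. assert (q x <= q x - eps / 2 * (d / 2)); [|nra].
    apply Hle. intros c z Hz Hc. apply Rnot_lt_le. intros Hlt. apply HN. now exists c, z. }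
  destruct (U_open y Hy) as (r1 & Hr1 & HU1).
  destruct (lower_slope_open _ _ _ _ _ Hc) as (r2 & Hr2 & Ho2).
  destruct (Rmin_pos_bounds r1 r2) as (r3 & Hr3 & H31 & H32); trivial.
  assert (HU : forall z, dist X z y < r3 -> U z) by (intros z Hz; apply HU1; unfold ball; lra).
  exists l, y, r3. repeat split; try apply Hl; trivial.
  intros v z a Hv Hz Ha.
  assert (Hlow := Ho2 z ltac:(lra)).
  apply (lower_slope_scal _ _ (d / 2)) in Ha; [|lra].
  (* This gives [c + d / 2 * a <= q (x + d / 2 v)]; differentiability and the choice of [c] each
     cost [eps / 2] after division by [d / 2]. *)
  pose proof (lower_slope_add _ _ _ _ _ _ _ Hlow Ha) as Hsum.
  apply Hub in Hsum; auto.
  assert (Hn : vnorm (vscal (d / 2) v) = d / 2) by (rewrite vnorm_scal_ge0, Hv by lra; ring).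
  specialize (Hq (vscal (d / 2) v)). rewrite Hn in Hq.
  specialize (Hq ltac:(lra) I). apply Rabs_le_bounds in Hq.
  destruct Hl as (_ & Hls & _). rewrite Hls in Hq.
  apply Rmult_le_reg_l with (d / 2); nra.
Qed.
End GenericDirections.

(** * Bounded decompositions along the direct sum *)

Section DirectSum.
Variable X : Banach.

Lemma vsum_scal (n : nat) (a : R) (y : nat -> X) :
  vscal a (vsum X n y) = vsum X n (fun i => vscal a (y i)).
Proof.
  induction n as [|n IH]; simpl; [vring|]. now rewrite ax_scal_distr_v, IH.
Qed.

Lemma vnorm_vsum_le (n : nat) (y : nat -> X) (M : R) :
  (forall i, (i < n)%nat -> vnorm (y i) <= M) -> vnorm (vsum X n y) <= INR n * M.
Proof.
  induction n as [|n IH]; intros H; [simpl; rewrite vnorm_0; lra|].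
  rewrite S_INR. simpl vsum.
  pose proof (ax_norm_triangle _ (vsum X n y) (y n)).
  specialize (IH (fun i Hi => H i (Nat.lt_lt_succ_r _ _ Hi))). specialize (H n (Nat.lt_succ_diag_r n)).
  lra.
Qed.

Lemma bounded_of_homogeneous (P : X -> X) :
  continuous X P -> (forall a x, P (vscal a x) = vscal a (P x)) ->
  exists C, 0 <= C /\ forall x, vnorm (P x) <= C * vnorm x.
Proof.
  intros Hc Hh.
  assert (H0 : P vzero = vzero) by (rewrite <- (vscal_0_l X vzero), Hh; vring).
  destruct (Hc vzero 1) as (d & Hd & HP); [lra|].
  (* Rescaled to norm [d / 2], a vector has an image of norm below 1. *)
  exists (2 / d). split; [left; apply Rdiv_lt_0_compat; lra|]. intros x.
  destruct (Req_dec (vnorm x) 0) as [Hx|Hx].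
  - rewrite (ax_norm_eq0 _ _ Hx), H0, vnorm_0. lra.
  - pose proof (vnorm_ge0 X x).
    assert (Hk : 0 < d / (2 * vnorm x)) by (apply Rdiv_lt_0_compat; lra).
    specialize (HP (vscal (d / (2 * vnorm x)) x)). rewrite H0, Hh in HP. unfold dist in HP.
    replace (vsub X (vscal (d / (2 * vnorm x)) x) vzero)
      with (vscal (d / (2 * vnorm x)) x) in HP by vring.
    replace (vsub X (vscal (d / (2 * vnorm x)) (P x)) vzero)
      with (vscal (d / (2 * vnorm x)) (P x)) in HP by vring.
    rewrite !vnorm_scal_ge0 in HP by lra.
    assert (Hlt : d / (2 * vnorm x) * vnorm (P x) < 1).
    { apply HP. replace (d / (2 * vnorm x) * vnorm x) with (d / 2) by (field; lra). lra. }
    left. apply Rmult_lt_reg_l with (d / (2 * vnorm x)); trivial.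
    replace (d / (2 * vnorm x) * (2 / d * vnorm x)) with 1 by (field; lra). trivial.
Qed.

(** Uniqueness of decompositions makes the projections homogeneous, and homogeneity with continuity
    at zero bounds each of them. *)
Lemma direct_sum_bounded_decomposition (n : nat) (Xi : nat -> X -> Prop) :
  direct_sum X n Xi -> exists C, 0 <= C /\
    forall h, exists u : nat -> X, vsum X n u = h /\
      forall i, (i < n)%nat -> Xi i (u i) /\ vnorm (u i) <= C * vnorm h.
Proof.
  intros (Hsub & Huniq & P & Hcont & HP & Hsum).
  assert (Hhom : forall i a x, (i < n)%nat -> P i (vscal a x) = vscal a (P i x)).
  { intros i a x Hi.
    apply (Huniq (fun i => P i (vscal a x)) (fun i => vscal a (P i x))); trivial.
    - intros j Hj. now apply HP.
    - intros j Hj. destruct (Hsub j Hj) as [(_ & _ & Hs & _) _]. now apply Hs, HP.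
    - now rewrite Hsum, <- vsum_scal, Hsum. }
  assert (exists C, 0 <= C /\ forall i x, (i < n)%nat -> vnorm (P i x) <= C * vnorm x) as (C & HC & HPC).
  { assert (Hk : forall k, (k <= n)%nat ->
      exists C, 0 <= C /\ forall i x, (i < k)%nat -> vnorm (P i x) <= C * vnorm x).
    { induction k as [|k IH]; intros Hk.
      - exists 0. split; [lra|]. intros; lia.
      - destruct IH as (C & HC & HCk); [lia|].
        destruct (bounded_of_homogeneous (P k)) as (C' & HC' & HCk').
        { apply Hcont; lia. }
        { intros a x. apply Hhom; lia. }
        exists (Rmax C C'). pose proof (Rmax_l C C'). pose proof (Rmax_r C C').
        split; [lra|]. intros i x Hi. pose proof (vnorm_ge0 X x).
        destruct (Nat.eq_dec i k) as [->|Hne].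
        + specialize (HCk' x). nra.
        + specialize (HCk i x ltac:(lia)). nra. }
    now apply Hk. }
  exists C. split; trivial. intros h. exists (fun i => P i h). split; trivial.
  intros i Hi. split; auto.
Qed.
End DirectSum.

(** * Approximation by a linear functional on a ball *)

Section LocalLinearApproximation.
Variable X : Banach.
Variables (G U : X -> Prop) (f : X -> R) (L : R).
Hypothesis U_open : is_open X U.
Hypothesis U_sub : forall x, U x -> G x.
Hypothesis L_ge0 : 0 <= L.
Hypothesis f_lip : forall x y, U x -> U y -> Rabs (f x - f y) <= L * dist X x y.
Variables (n : nat) (Xi : nat -> X -> Prop).
Hypothesis X_sum : direct_sum X n Xi.
Hypothesis X_asplund : Asplund X.
Hypothesis smooth_dirs : forall i, (i < n)%nat -> exists D : X -> Prop,
  dense_in X D (unit_sphere X (Xi i)) /\ forall v, D v -> ess_smooth_generic_lines X G f v.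

Lemma unit_sphere_normalize (i : nat) (u : X) : (i < n)%nat -> Xi i u -> u <> vzero ->
  unit_sphere X (Xi i) (vscal (/ vnorm u) u) /\ u = vscal (vnorm u) (vscal (/ vnorm u) u).
Proof.
  intros Hi Hu Hne.
  assert (Hn : vnorm u <> 0) by (intros H; now apply Hne, ax_norm_eq0).
  pose proof (vnorm_ge0 X u).
  repeat split.
  - destruct X_sum as [Hs _]. destruct (Hs i Hi) as [(_ & _ & Hsc & _) _]. now apply Hsc.
  - rewrite vnorm_scal_ge0 by (left; apply Rinv_0_lt_compat; lra). now apply Rinv_l.
  - rewrite ax_scal_assoc, Rinv_r, ax_scal_1; trivial.
Qed.

(** Each nonzero component of [x] is a positive multiple of a limit of essentially smooth
    directions. *)
Lemma all_directions_generic (x : X) : generic_direction X U f x.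
Proof.
  destruct (direct_sum_bounded_decomposition X n Xi X_sum) as (C & _ & Hdec).
  destruct (Hdec x) as (u & <- & Hu).
  assert (Hk : forall k, (k <= n)%nat -> generic_direction X U f (vsum X k u)).
  { induction k as [|k IH]; intros Hk; simpl; [apply generic_direction_zero|].
    apply generic_direction_add; [apply IH; lia|].
    destruct (Hu k) as [Huk _]; [lia|].
    destruct (classic (u k = vzero)) as [->|Hne]; [apply generic_direction_zero|].
    destruct (unit_sphere_normalize k (u k)) as [Hs ->]; [lia | trivial | trivial |].
    apply generic_direction_scal; [apply vnorm_ge0|].
    destruct (smooth_dirs k) as (D & [HD1 HD2] & HD); [lia|].
    apply (generic_direction_limit X U f L); trivial. intros e He.
    destruct (HD2 _ e Hs He) as (v & Hv & Hd). exists v. split; trivial.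
    apply (generic_direction_ess_smooth X G U f L); auto. now apply HD1. }
  now apply Hk.
Qed.

Lemma local_linear_approximation (y0 : X) (eps : R) : U y0 -> 0 < eps ->
  exists l y r, bounded_linear X l /\ 0 < r /\ (forall z, dist X z y < r -> U z) /\
    forall z, dist X z y < r -> exists d, 0 < d /\ forall h, vnorm h < d ->
      Rabs (f (vadd z h) - f z - l h) <= eps * vnorm h.
Proof.
  intros Hy0 Heps.
  destruct (direct_sum_bounded_decomposition X n Xi X_sum) as (C & HC & Hdec).
  assert (HnC : 0 <= INR n * C) by (apply Rmult_le_pos; [apply pos_INR | trivial]).
  (* Each of the [n] components has norm at most [C] times that of [h] and contributes an error
     [3 * e] per unit length. *)
  destruct (small_factor eps (3 * (INR n * C))) as (e & He & HeC); try lra.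
  destruct (asplund_slope_bound X U f L U_open L_ge0 f_lip all_directions_generic X_asplund y0 e Hy0 He)
    as (l & y & r & Hl & Hr & HU & Hbound).
  pose proof Hl as (Hla & Hls & (M & HM)).
  assert (Hl0 : l vzero = 0) by (rewrite <- (vscal_0_l X vzero), Hls; ring).
  assert (Hln : forall x, l (vopp x) = - l x) by (intros x; rewrite vopp_scal, Hls; ring).
  assert (Hunit : forall i u z, (i < n)%nat -> unit_sphere X (Xi i) u -> dist X z y < r ->
    lower_slope X f u (l u - 3 * e) z).
  { intros i u z Hi Hu Hz. destruct (smooth_dirs i Hi) as (D & [HD1 HD2] & HD).
    pose proof (Rabs_pos M).
    destruct (small_factor e (L + Rabs M)) as (e' & He' & HeL); try lra.
    destruct (HD2 u e' Hu He') as (v & Hv & Hd).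
    destruct (HD1 v Hv) as [_ Hv1].
    assert (Hlow : lower_slope X f v (l v - 2 * e) z).
    { apply (ess_smooth_slope_dichotomy X G U f L) with (y := y) (r := r); auto.
      intros z' Hz' Hn. apply Hbound in Hn; [|now rewrite vnorm_opp | trivial].
      rewrite Hln in Hn. lra. }
    apply (lower_slope_perturb X f U L) with (x' := u) in Hlow; auto.
    change (vnorm (vsub X u v)) with (dist X u v) in Hlow. rewrite dist_sym in Hlow.
    apply lower_slope_le with (2 := Hlow).
    assert (Hlv : Rabs (l v - l u) <= M * dist X v u).
    { replace (l v - l u) with (l (vsub X v u)); [apply HM|].
      unfold vsub. rewrite Hla, Hln. ring. }
    apply Rabs_le_bounds in Hlv. pose proof (RRle_abs M). pose proof (dist_ge0 X v u). nra. }
  assert (Hseg : forall i u z, (i < n)%nat -> Xi i u -> dist X z y + vnorm u < r ->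
    l u - 3 * e * vnorm u <= f (vadd z u) - f z).
  { intros i u z Hi Hu Hz.
    apply (lower_slope_segment X f U L); trivial. intros s Hs.
    assert (Hzs : dist X (vadd z (vscal s u)) y < r).
    { pose proof (dist_tri X (vadd z (vscal s u)) z y) as Htri.
      rewrite dist_vadd_self, vnorm_scal_ge0 in Htri by lra. pose proof (vnorm_ge0 X u). nra. }
    split; auto.
    destruct (classic (u = vzero)) as [->|Hne].
    - rewrite Hl0, vnorm_0. apply lower_slope_le with (c := 0); [lra | apply lower_slope_zero].
    - destruct (unit_sphere_normalize i u Hi Hu Hne) as [Hsph Heq].
      set (u1 := vscal (/ vnorm u) u) in *. set (k := vnorm u) in *.
      replace (l u - 3 * e * k) with (k * (l u1 - 3 * e)) by (rewrite Heq, Hls; ring).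
      rewrite Heq at 1. apply lower_slope_scal; [apply vnorm_ge0|].
      now apply (Hunit i). }
  (* The path from [z] to [z + h] follows the components in turn; its length is at most [INR n * C]
     times the norm of [h], which keeps it in the ball. *)
  assert (Hlow : forall z h, dist X z y + (INR n * C) * vnorm h < r ->
    l h - 3 * e * (INR n * C) * vnorm h <= f (vadd z h) - f z).
  { intros z h Hzh. destruct (Hdec h) as (u & Hu & Hui). set (H := vnorm h) in *.
    assert (HH : 0 <= H) by apply vnorm_ge0.
    assert (Hk : forall k, (k <= n)%nat ->
      l (vsum X k u) - 3 * e * (INR k * C) * H <= f (vadd z (vsum X k u)) - f z).
    { induction k as [|k IH]; intros Hk.
      - simpl. rewrite Hl0, ax_add_0. lra.
      - specialize (IH ltac:(lia)). simpl vsum.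
        destruct (Hui k) as [Hxk Hnk]; [lia|].
        assert (Hnorm : vnorm (vsum X k u) <= INR k * (C * H)).
        { apply vnorm_vsum_le. intros i Hi. apply Hui. lia. }
        assert (Hkn : INR (S k) <= INR n) by now apply le_INR.
        rewrite S_INR in *.
        assert (HCH : 0 <= C * H) by now apply Rmult_le_pos.
        assert (Hstep := Hseg k (u k) (vadd z (vsum X k u)) ltac:(lia) Hxk).
        pose proof (dist_tri X (vadd z (vsum X k u)) z y) as Htri. rewrite dist_vadd_self in Htri.
        specialize (Hstep ltac:(nra)).
        replace (vadd z (vadd (vsum X k u) (u k))) with (vadd (vadd z (vsum X k u)) (u k)) by vring.
        rewrite Hla. nra. }
    specialize (Hk n (Nat.le_refl n)). now rewrite Hu in Hk. }
  exists l, y, r. do 3 (split; [assumption|]). intros z Hz.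
  destruct (small_factor (r - dist X z y) (INR n * C + 1)) as (d & Hd & HdC); try lra.
  exists d. split; trivial. intros h Hh. pose proof (vnorm_ge0 X h) as Hh0.
  assert (H1 := Hlow z h ltac:(nra)).
  (* The upper estimate is the lower one for the way back; the summand 1 in the choice of [d] allows
     for the displaced starting point. *)
  assert (H2 := Hlow (vadd z h) (vopp h)). rewrite vnorm_opp, Hln in H2.
  pose proof (dist_tri X (vadd z h) z y) as Htri. rewrite dist_vadd_self in Htri.
  specialize (H2 ltac:(nra)).
  replace (vadd (vadd z h) (vopp h)) with z in H2 by vring.
  apply Rabs_le. nra.
Qed.
End LocalLinearApproximation.

(** * Derivatives up to a fixed error *)

Section ApproximateDerivatives.
Variable X : Banach.

Definition almost_diff (f : X -> R) (x : X) (eps : R) (l : X -> R) : Prop :=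
  bounded_linear X l /\ exists d, 0 < d /\ forall h, vnorm h < d ->
    Rabs (f (vadd x h) - f x - l h) <= eps * vnorm h.

(** Both functionals approximate the same increment at a small multiple [t h], and homogeneity
    removes [t]. *)
Lemma almost_diff_close (f : X -> R) (x : X) (a b : R) (l m : X -> R) :
  almost_diff f x a l -> almost_diff f x b m ->
  forall h, Rabs (l h - m h) <= (a + b) * vnorm h.
Proof.
  intros [(_ & Hl & _) (d1 & Hd1 & H1)] [(_ & Hm & _) (d2 & Hd2 & H2)] h.
  pose proof (vnorm_ge0 X h) as Hh.
  destruct (Rmin_pos_bounds d1 d2) as (d & Hd & Hda & Hdb); trivial.
  destruct (small_factor d (vnorm h)) as (t & Ht & Htd); trivial.
  assert (Hn : vnorm (vscal t h) = t * vnorm h) by (apply vnorm_scal_ge0; lra).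
  specialize (H1 (vscal t h)). specialize (H2 (vscal t h)). rewrite Hn in H1, H2.
  specialize (H1 ltac:(lra)). specialize (H2 ltac:(lra)). rewrite Hl in H1. rewrite Hm in H2.
  apply Rabs_le_bounds in H1. apply Rabs_le_bounds in H2.
  apply Rabs_le. split; apply Rmult_le_reg_l with t; trivial; lra.
Qed.

Lemma Rabs_small_eq0 (a M : R) : 0 <= M -> (forall k, Rabs a <= M * / INR (S k)) -> a = 0.
Proof.
  intros HM H. apply NNPP. intros Ha. apply Rabs_pos_lt in Ha.
  destruct (small_factor (Rabs a) M Ha HM) as (e & He & HeM).
  destruct (archimed_inv e He) as [k Hk]. specialize (H k). nra.
Qed.

(** By [almost_diff_close] the approximate derivatives are Cauchy in operator norm; their limit is
    the derivative. *)
Lemma frechet_diff_of_almost_diff (G : X -> Prop) (f : X -> R) (x : X) : G x ->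
  (forall k, exists l, almost_diff f x (/ INR (S k)) l) -> frechet_diff X G f x.
Proof.
  intros Gx H.
  set (lk := fun k => proj1_sig (constructive_indefinite_description _ (H k))).
  assert (Hlk : forall k, almost_diff f x (/ INR (S k)) (lk k))
    by (intros k; exact (proj2_sig (constructive_indefinite_description _ (H k)))).
  assert (Hpos : forall k, 0 < / INR (S k)) by (intros k; apply Rinv_0_lt_compat, lt_0_INR; lia).
  assert (Hmono : forall k m, (k <= m)%nat -> / INR (S m) <= / INR (S k)).
  { intros k m Hkm. apply Rinv_le_contravar; [apply lt_0_INR; lia | apply le_INR; lia]. }
  assert (Hclose : forall k m h, (k <= m)%nat -> Rabs (lk m h - lk k h) <= 2 * / INR (S k) * vnorm h).
  { intros k m h Hkm. pose proof (almost_diff_close _ _ _ _ _ _ (Hlk m) (Hlk k) h).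
    specialize (Hmono k m Hkm). pose proof (vnorm_ge0 X h). nra. }
  assert (Hcv : forall h, {c | Un_cv (fun k => lk k h) c}).
  { intros h. apply R_complete. intros e He.
    destruct (small_factor e (4 * vnorm h) He) as (e' & He' & Hee).
    { pose proof (vnorm_ge0 X h); lra. }
    destruct (archimed_inv e' He') as [N HN]. exists N. intros a b Ha Hb. unfold R_dist.
    pose proof (Hclose N a h Ha) as H1. pose proof (Hclose N b h Hb) as H2.
    apply Rabs_le_bounds in H1. apply Rabs_le_bounds in H2.
    pose proof (vnorm_ge0 X h). apply Rabs_def1; nra. }
  set (l := fun h => proj1_sig (Hcv h)).
  assert (Hl : forall k h, Rabs (l h - lk k h) <= 2 * / INR (S k) * vnorm h).
  { intros k h. apply le_epsilon. intros e He.
    destruct (proj2_sig (Hcv h) e He) as [N HN].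
    specialize (HN (max N k) (Nat.le_max_l _ _)). fold (l h) in HN. unfold R_dist in HN.
    specialize (Hclose k (max N k) h (Nat.le_max_r _ _)).
    rewrite Rabs_minus_sym in HN.
    replace (l h - lk k h) with ((l h - lk (max N k) h) + (lk (max N k) h - lk k h)) by ring.
    pose proof (Rabs_triang (l h - lk (max N k) h) (lk (max N k) h - lk k h)). lra. }
  assert (Hlin : bounded_linear X l).
  { repeat split.
    - intros a b. apply Rminus_diag_uniq.
      pose proof (vnorm_ge0 X a) as Ha. pose proof (vnorm_ge0 X b) as Hb.
      pose proof (vnorm_ge0 X (vadd a b)) as Hab.
      apply Rabs_small_eq0 with (2 * (vnorm a + vnorm b + vnorm (vadd a b))); [lra|].
      intros k. destruct (Hlk k) as [(Hadd & _) _].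
      pose proof (Hl k a) as H1. pose proof (Hl k b) as H2. pose proof (Hl k (vadd a b)) as H3.
      rewrite Hadd in H3. apply Rabs_le_bounds in H1, H2, H3. apply Rabs_le. lra.
    - intros c a. apply Rminus_diag_uniq.
      pose proof (vnorm_ge0 X a) as Ha. pose proof (vnorm_ge0 X (vscal c a)) as Hca.
      pose proof (Rabs_pos c) as Hc.
      apply Rabs_small_eq0 with (2 * (vnorm (vscal c a) + Rabs c * vnorm a)).
      { assert (0 <= Rabs c * vnorm a) by now apply Rmult_le_pos. lra. }
      intros k. destruct (Hlk k) as [(_ & Hsc & _) _].
      pose proof (Hl k a) as H1. pose proof (Hl k (vscal c a)) as H3. rewrite Hsc in H3.
      replace (l (vscal c a) - c * l a)
        with ((l (vscal c a) - c * lk k a) + - (c * (l a - lk k a))) by ring.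
      eapply Rle_trans; [apply Rabs_triang|]. rewrite Rabs_Ropp, Rabs_mult. nra.
    - destruct (Hlk O) as [(_ & _ & (M & HM)) _].
      exists (M + 2 * / INR 1). intros a. specialize (HM a). specialize (Hl O a).
      replace (l a) with ((l a - lk O a) + lk O a) by ring.
      eapply Rle_trans; [apply Rabs_triang|]. lra. }
  split; trivial. exists l. split; trivial. intros e He.
  (* One third is the error of [lk k]; two thirds cover its distance to [l]. *)
  destruct (archimed_inv (e / 3)) as [k Hk]; [lra|].
  destruct (Hlk k) as [_ (d & Hd & Hdk)]. exists d. split; trivial.
  intros h Hh _. specialize (Hdk h Hh). specialize (Hl k h).
  apply Rabs_le_bounds in Hdk, Hl. pose proof (vnorm_ge0 X h). apply Rabs_le. nra.
Qed.
End ApproximateDerivatives.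

(** * Residuality of the set of points of differentiability *)

Theorem mainTheorem17 (X : Banach) (n : nat) (Xi : nat -> X -> Prop)
  (G : X -> Prop) (f : X -> R) :
  direct_sum X n Xi -> Asplund X ->
  is_open X G -> locally_lipschitz X G f ->
  (forall i, (i < n)%nat -> exists D : X -> Prop,
      dense_in X D (unit_sphere X (Xi i)) /\
      forall v, D v -> ess_smooth_generic_lines X G f v) ->
  generically_frechet_diff X G f.
Proof.
  intros Hsum Hasp HG Hlip Hsmooth.
  exists (fun k x => G x /\ ~ exists l, almost_diff X f x (/ INR (S k)) l). split.
  2: { intros x [Gx Hx]. apply NNPP. intros HN. apply Hx.
       apply frechet_diff_of_almost_diff; trivial.
       intros k. apply NNPP. intros Hk. apply HN. now exists k. }
  intros k x r Hr.
  assert (Hk : 0 < / INR (S k)) by (apply Rinv_0_lt_compat, lt_0_INR; lia).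
  destruct (classic (exists g, dist X g x < r /\ G g)) as [(g & Hg & Gg)|HN].
  (* A ball that misses [G] is its own hole. *)
  2: { exists x, r. repeat split; trivial. intros z Hz [Gz _]. apply HN. now exists z. }
  destruct (HG g Gg) as (r1 & Hr1 & HG1).
  destruct (Hlip g Gg) as (r2 & L & Hr2 & HL).
  destruct (Rmin_pos_bounds r1 r2) as (r3 & Hr3 & H31 & H32); trivial.
  destruct (Rmin_pos_bounds r3 (r - dist X g x)) as (r4 & Hr4 & H43 & H4r); try lra.
  set (U := fun z => dist X z g < r4).
  assert (HUG : forall z, U z -> G z) by (intros z Hz; apply HG1; unfold ball, U in *; lra).
  (* The local Lipschitz constant comes without a sign, hence [Rabs L]. *)
  destruct (local_linear_approximation X G U f (Rabs L)) with (n := n) (Xi := Xi)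
    (y0 := g) (eps := / INR (S k)) as (l & y & s & Hl & Hs & HUs & Happ); trivial.
  - intros z Hz. exists (r4 - dist X z g). unfold U, ball in *. split; [lra|].
    intros w Hw. pose proof (dist_tri X w z g). lra.
  - apply Rabs_pos.
  - intros a b Ha Hb. apply Rle_trans with (L * dist X a b).
    + apply HL; auto; unfold ball, U in *; lra.
    + apply Rmult_le_compat_r; [apply dist_ge0 | apply RRle_abs].
  - unfold U. now rewrite dist_self.
  - exists y, s. repeat split; trivial.
    + intros z Hz. specialize (HUs z Hz). unfold U, ball in *.
      pose proof (dist_tri X z g x). lra.
    + intros z Hz [_ Hn]. apply Hn. exists l. split; auto.
Qed.
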